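(* Let $(X,T)$ be a topological space and let $\Phi\subseteq C_b(X,\mathbb R)$. Then: (i) $\widetilde X_\Phi={}^*X$. (ii) $(\widehat X_\Phi,\widehat T)$ is a compact space containing a continuous image of $(X,T)$ (namely $q[X]$, the image of $X$ under the restriction to $X$ of the quotient map $q:\widetilde X_\Phi\to\widehat X_\Phi$).
   Context: Nonstandard setting. Let $S\supseteq X\cup\mathbb R$ be a set of individuals, with superstructure $V(S)=\bigcup_{k\ge 0}V_k(S)$, $V_0(S)=S$, $V_{k+1}(S)=V_k(S)\cup\mathcal P(V_k(S))$. A $\kappa$-saturated nonstandard model of $S$ is a superstructure $V({}^*S)$ with a map $A\mapsto {}^*A$ from $V(S)$ into $V({}^*S)$ satisfying: (Extension) ${}^*s=s$ for all $s\in S$; (Transfer) a bounded quantifier formula $\Psi(A_1,\dots,A_n)$ with constants in $V(S)$ is true iff $\Psi({}^*A_1,\dots,{}^*A_n)$ is true in $V({}^*S)$; (Saturation) every family of at most $\kappa$ internal sets with the finite intersection property has nonempty intersection. An entity of $V({}^*S)$ is internal if it is an element of ${}^*A$ for some $A\in V(S)$. Throughout, a $\kappa$-saturated model with $\kappa$ infinite and $\kappa>\operatorname{card}T$ is fixed; $X\subseteq {}^*X$. The standard topology ${}^sT$ on ${}^*X$ has base $\{{}^*G:G\in T\}$. $C_b(X,\mathbb R)$ is the set of continuous bounded real-valued functions on $(X,T)$ ($\mathbb R$ with the usual topology). In ${}^*\mathbb R$: $\xi$ is finite if $|\xi|<n$ for some $n\in\mathbb N$; $\xi\approx\eta$ if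 $|\xi-\eta|<1/n$ for all $n\in\mathbb N$. For a set $\Phi$ of continuous real-valued functions on $X$: $\widetilde X_\Phi=\{\alpha\in{}^*X: {}^*f(\alpha)\text{ is finite for all } f\in\Phi\}$ with the subspace topology from $({}^*X,{}^sT)$; for $\alpha,\beta\in\widetilde X_\Phi$, $\alpha\sim_\Phi\beta$ iff ${}^*f(\alpha)\approx{}^*f(\beta)$ for all $f\in\Phi$; $\widehat X_\Phi=\widetilde X_\Phi/\!\sim_\Phi$ with the quotient topology $\widehat T$. *)

(* Defs.v *)
From HB Require Import structures.
From mathcomp Require Import all_boot all_order all_algebra.
From mathcomp Require Import all_classical all_reals all_analysis.
Import Order.TTheory GRing.Theory Num.Theory.
Import numFieldNormedType.Exports.

Set Implicit Arguments.
Unset Strict Implicit.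
Unset Printing Implicit Defensive.

Local Open Scope classical_set_scope.
Local Open Scope ring_scope.
Local Open Scope card_scope.
Local Open Scope quotient_scope.

(** * Superstructures *)

(* [level indiv elem k] is V_k(S), for the individuals [range indiv] and the
   membership relation [elem]: V_0 = S and V_{k+1} = V_k `|` P(V_k). *)
Fixpoint level (S U : Type) (indiv : S -> U) (elem : U -> U -> Prop)
    (k : nat) : set U :=
  if k is k'.+1 then
    level indiv elem k' `|`
    [set a | ~ range indiv a /\ elem^~ a `<=` level indiv elem k']
  else range indiv.

(* V(S) is described up to (unique) isomorphism: individuals have no elements,
   sets are extensional, every subset of a V_k(S) is an entity, and V(S) is the
   union of the V_k(S).  Existence is [superstructure_exists] below. *)
Record superstructure (S : Type) := Superstructure {
  entity :> choiceType;
  indiv : S -> entity;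
  elem : entity -> entity -> Prop;
  indiv_inj : injective indiv;
  elem_indiv : forall x s, ~ elem x (indiv s);
  entity_ext : forall a b, ~ range indiv a -> ~ range indiv b ->
    (forall x, elem x a <-> elem x b) -> a = b;
  level_pow : forall k (P : set entity), P `<=` level indiv elem k ->
    exists a, ~ range indiv a /\ forall x, elem x a <-> P x;
  level_exhaust : forall a, exists k, level indiv elem k a
}.

Arguments indiv {S s0} s.
Arguments elem {S s} x a : rename.

Notation "x ∈ a" := (elem x a) (at level 70, no associativity).

Section superstructure_theory.
Context {S : Type} {V : superstructure S}.
Implicit Types (x y a b u v p F : V) (P : set V).

Definition is_set a := ~ range (@indiv S V) a.

Lemma elem_is_set x a : x ∈ a -> is_set a.
Proof. by move=> xa [s _ sa]; move: xa; rewrite -sa; exact: elem_indiv. Qed.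

Definition empty_entity : V :=
  projT1 (cid (@level_pow S V 0 set0 (@sub0set _ _))).

(* The entity {x | P x}, when P is contained in some V_k(S). *)
Definition collect P : V :=
  xget empty_entity [set a | is_set a /\ forall x, x ∈ a <-> P x].

Definition upair a b : V := collect [set x | x = a \/ x = b].
Definition opair a b : V := upair (upair a a) (upair a b).

(* The value at a of the function (set of ordered pairs) F. *)
Definition app F a : V := xget F [set b | opair a b ∈ F].

Lemma level_le k l : (k <= l)%N ->
  level (@indiv S V) elem k `<=` level (@indiv S V) elem l.
Proof.
elim: l => [|l IH]; first by rewrite leqn0 => /eqP ->.
rewrite leq_eqVlt => /predU1P[-> //|]; rewrite ltnS => /IH kl x kx.
by left; exact: kl.
Qed.

Lemma collect_spec k P : P `<=` level (@indiv S V) elem k ->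
  is_set (collect P) /\ forall x, x ∈ collect P <-> P x.
Proof.
move=> /level_pow[a aP]; rewrite /collect.
by case: xgetP => [b _ //|/(_ a)]; case.
Qed.

Lemma collectP k P x : P `<=` level (@indiv S V) elem k ->
  x ∈ collect P <-> P x.
Proof. by move=> /collect_spec[_]; apply. Qed.

Lemma collect_level k P : P `<=` level (@indiv S V) elem k ->
  level (@indiv S V) elem k.+1 (collect P).
Proof. by move=> /[dup] Pk /collect_spec[sP EP]; right; split => // x /EP/Pk. Qed.

Lemma upair_spec a b :
  is_set (upair a b) /\ forall x, x ∈ upair a b <-> x = a \/ x = b.
Proof.
have [k ka] := level_exhaust a; have [l lb] := level_exhaust b.
apply: (@collect_spec (maxn k l)) => x [] ->.
  by apply: level_le ka; rewrite leq_maxl.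
by apply: level_le lb; rewrite leq_maxr.
Qed.

Lemma elem_upair a b x : x ∈ upair a b <-> x = a \/ x = b.
Proof. exact: (upair_spec a b).2. Qed.

Lemma upair_level k a b : level (@indiv S V) elem k a ->
  level (@indiv S V) elem k b -> level (@indiv S V) elem k.+1 (upair a b).
Proof. by move=> ka kb; apply: collect_level => x [] ->. Qed.

Lemma opair_level k a b : level (@indiv S V) elem k a ->
  level (@indiv S V) elem k b -> level (@indiv S V) elem k.+2 (opair a b).
Proof. by move=> ka kb; do 2!apply: upair_level => //; apply: upair_level. Qed.

Lemma upairP u a b :
  (a ∈ u /\ b ∈ u) /\ (forall w, w ∈ u -> w = a \/ w = b) <-> u = upair a b.
Proof.
split=> [[[au bu] uab]|->]; last first.
  by split=> [|w /elem_upair //]; split; apply/elem_upair; [left|right].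
apply: entity_ext (elem_is_set au) (upair_spec a b).1 _ => x.
by split=> [/uab/elem_upair //|/elem_upair[] ->].
Qed.

Lemma upair_inj a b c d : upair a b = upair c d ->
  (a = c /\ b = d) \/ (a = d /\ b = c).
Proof.
move=> E.
have := (elem_upair c d a).1; rewrite -E => /(_ ((elem_upair a b a).2 (or_introl erefl))).
have := (elem_upair c d b).1; rewrite -E => /(_ ((elem_upair a b b).2 (or_intror erefl))).
have := (elem_upair a b c).1; rewrite E => /(_ ((elem_upair c d c).2 (or_introl erefl))).
have := (elem_upair a b d).1; rewrite E => /(_ ((elem_upair c d d).2 (or_intror erefl))).
by move=> [] ? [] ? [] ? [] ?; subst; auto.
Qed.

Lemma opair_inj a b c d : opair a b = opair c d -> a = c /\ b = d.
Proof.
move=> /upair_inj[] [] /upair_inj[] [] ? ? /upair_inj[] [] ? ?; subst; auto.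
Qed.

End superstructure_theory.

(** ** Existence of superstructures *)

Section existence.
Variable S : Type.

Fixpoint tower (k : nat) : Type :=
  if k is k'.+1 then (S + set (tower k'))%type else S.

Definition tower_view (k : nat) : tower k -> S + {l : nat & set (tower l)} :=
  match k with
  | 0 => inl
  | l.+1 => fun x => match x with
    | inl s => inl s
    | inr A => inr (existT (fun l => set (tower l)) l A)
    end
  end.

(* Equality of the entities denoted at possibly different stages. *)
Fixpoint same (k l : nat) {struct k} : tower k -> tower l -> Prop :=
  match k return tower k -> tower l -> Prop with
  | 0 => fun x y => tower_view y = inl x
  | k'.+1 => fun x y =>
    match x, tower_view y with
    | inl s, inl t => s = t
    | inr A, inr (existT m B) =>
      (forall a, A a -> exists2 b, B b & @same k' m a b) /\
      (forall b, B b -> exists2 a, A a & @same k' m a b)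
    | _, _ => False
    end
  end.

Lemma sameE k l (x : tower k) (y : tower l) : same x y <->
  match tower_view x, tower_view y with
  | inl s, inl t => s = t
  | inr (existT m A), inr (existT n B) =>
    (forall a, A a -> exists2 b, B b & same a b) /\
    (forall b, B b -> exists2 a, A a & same a b)
  | _, _ => False
  end.
Proof.
case: k x => [|k] x; last by case: x.
by rewrite /=; case: (tower_view y) => [t|[]]; split => // [[]|->].
Qed.

Lemma same_refl k (x : tower k) : same x x.
Proof.
elim: k x => [//|k IH] [s //|A]; split => a Aa; exists a => //; exact: IH.
Qed.

Lemma same_sym k l (x : tower k) (y : tower l) : same x y -> same y x.
Proof.
elim: k l x y => [|k IH] l x y /sameE xy; apply/sameE; move: xy => /=.
  by case: (tower_view y).
case: x => [s|A]; case: (tower_view y) => // -[m B] [AB BA].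
by split=> [b /BA|a /AB] [c ? /IH ?]; exists c.
Qed.

Lemma same_trans k l m (x : tower k) (y : tower l) (z : tower m) :
  same x y -> same y z -> same x z.
Proof.
elim: k l m x y z => [|k IH] l m x y z /sameE xy /sameE yz; apply/sameE;
    move: xy yz => /=.
  by case: (tower_view y) => // s ->.
case: x => [s|A]; first by case: (tower_view y) => // t ->.
case: (tower_view y) => // -[i B]; case: (tower_view z) => // -[j C] [AB BA] [BC CB].
split=> [a /AB[b /BC[c ? ?] ?]|c /CB[b /BA[a ? ?] ?]].
  by exists c => //; apply: IH; eauto.
by exists a => //; apply: IH; eauto.
Qed.

Let code := {k : nat & tower k}.
Let cls k (x : tower k) : set code := fun c => same x (projT2 c).
Arguments cls {k} x.

Let carrier := {classic {C : set code | exists k (x : tower k), C = cls x}}.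
Let cl k (x : tower k) : carrier :=
  exist (fun C : set code => exists k (x : tower k), C = cls x) (cls x)
    (ex_intro _ k (ex_intro _ x erefl)).
Arguments cl {k} x.

Let clE k l (x : tower k) (y : tower l) : cl x = cl y <-> same x y.
Proof.
split=> [/(congr1 sval) /= E|xy].
  have : cls y (existT _ l y) by exact: same_refl.
  by rewrite -E.
apply: eq_exist => /=; apply/seteqP; split => c; rewrite /cls => h.
  by apply: same_trans h; exact: same_sym.
exact: same_trans h.
Qed.

Let clP (c : carrier) : exists k (x : tower k), c = cl x.
Proof. by case: c => C [k [x xC]]; exists k, x; apply: eq_exist. Qed.

Let ind (s : S) : carrier := @cl 0 s.
Let mm (c d : carrier) : Prop := exists k (A : set (tower k)),
  d = @cl k.+1 (inr A) /\ exists2 a, A a & c = cl a.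

Let mmE k (A : set (tower k)) c :
  mm c (@cl k.+1 (inr A)) <-> exists2 a, A a & c = cl a.
Proof.
split=> [|h]; last by exists k, A.
move=> [l [B [/clE [AB BA] [b Bb ->]]]].
by have [a Aa ab] := BA _ Bb; exists a => //; apply/clE/same_sym.
Qed.

Let indN k (A : set (tower k)) : ~ range ind (@cl k.+1 (inr A)).
Proof. by move=> [s _ /clE]. Qed.

Let setP c : ~ range ind c -> exists k (A : set (tower k)), c = @cl k.+1 (inr A).
Proof.
have [[|k] [x ->]] := clP c; first by case; exists x.
case: x => [s []|A _]; last by exists k, A.
by exists s => //; exact/clE.
Qed.

Let tower_up k (x : tower k) : exists y : tower k.+1, same x y.
Proof.
elim: k x => [|k IH] x; first by exists (inl x).
case: x => [s|A]; first by exists (inl s).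
exists (inr [set y : tower k.+1 | exists2 a : tower k, A a & same a y]).
split => [a Aa|y [a Aa ay]]; last by exists a.
by have [y ay] := IH a; exists y => //; exists a.
Qed.

Let levelE k c : level ind mm k c <-> exists x : tower k, c = cl x.
Proof.
elim: k c => [|k IH] c.
  by split=> [[s _ <-]|[s ->]]; exists s.
split=> [[/IH[x ->]|[cN ck]]|].
- by have [y xy] := tower_up x; exists y; apply/clE.
- have [l [B cB]] := setP cN.
  exists (inr [set a | exists2 b, B b & same a b]); rewrite cB; apply/clE.
  split=> [b Bb|a [b ? ?]]; last by exists b => //; exact: same_sym.
  have /IH[a /clE ba] : level ind mm k (cl b) by apply: ck; rewrite cB mmE; exists b.
  by exists a => //; exists b => //; exact: same_sym.
- move=> [[s ->|A ->]].
    suff : level ind mm 0 (@cl k.+1 (inl s)).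
      by elim: (k.+1) (@cl _ _) => [//|n IHn] d d0; left; exact: IHn.
    by exists s => //; exact/clE.
  right; split=> [|d]; first exact: indN.
  by rewrite mmE => -[a Aa ->]; apply/IH; exists a.
Qed.

Lemma superstructure_exists : inhabited (superstructure S).
Proof.
constructor; apply: (@Superstructure S carrier ind mm).
- by move=> s t /clE [].
- by move=> x s [k [A [/clE]]].
- move=> a b /setP[k [A ->]] /setP[l [B ->]] E; apply/clE; split.
  + move=> x Ax; have /mmE[y By /clE xy] : mm (cl x) (@cl l.+1 (inr B)).
      by apply/E/mmE; exists x.
    by exists y.
  + move=> y By; have /mmE[x Ax /clE xy] : mm (cl y) (@cl k.+1 (inr A)).
      by apply/E/mmE; exists y.
    by exists x => //; exact: same_sym.
- move=> k P Pk; exists (@cl k.+1 (inr [set a | P (cl a)])).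
  split=> [|x]; first exact: indN.
  rewrite mmE; split=> [[a ? ->//]|Px].
  by have /levelE[a xa] := Pk _ Px; exists a => //=; rewrite -xa.
- by move=> a; have [k [x ->]] := clP a; exists k; apply/levelE; exists x.
Qed.

End existence.

(** * Bounded quantifier formulas *)

(* De Bruijn syntax: variable i denotes the value e i of an environment e, and
   [FAll i f] / [FEx i f] are "for all / some x ∈ (variable i), f", with x
   being variable 0 in f.  The constants A_1, ..., A_n of the formula are the
   values given to its free variables. *)
Inductive formula : Type :=
| FElem of nat & nat
| FEq of nat & nat
| FNot of formula
| FAnd of formula & formula
| FOr of formula & formula
| FImp of formula & formula
| FAll of nat & formula
| FEx of nat & formula.

Definition scons (T : Type) (a : T) (e : nat -> T) (i : nat) : T :=
  if i is j.+1 then e j else a.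

Fixpoint holds (S : Type) (V : superstructure S) (e : nat -> V)
    (f : formula) : Prop :=
  match f with
  | FElem i j => e i ∈ e j
  | FEq i j => e i = e j
  | FNot g => ~ holds e g
  | FAnd g h => holds e g /\ holds e h
  | FOr g h => holds e g \/ holds e h
  | FImp g h => holds e g -> holds e h
  | FAll i g => forall x, x ∈ e i -> holds (scons x e) g
  | FEx i g => exists x, x ∈ e i /\ holds (scons x e) g
  end.

Section formulas.
Context {S : Type} {V : superstructure S}.
Implicit Types (e : nat -> V).

(* u = {x, y} *)
Definition f_upair (u x y : nat) : formula :=
  FAnd (FAnd (FElem x u) (FElem y u)) (FAll u (FOr (FEq 0 x.+1) (FEq 0 y.+1))).

(* p = <x, y> *)
Definition f_opair (p x y : nat) : formula :=
  FEx p (FEx p.+1 (FAnd (f_upair 1 x.+2 x.+2)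
    (FAnd (f_upair 0 x.+2 y.+2) (f_upair p.+2 1 0)))).

(* <x, y> ∈ F *)
Definition f_rel (F x y : nat) : formula := FEx F (f_opair 0 x.+1 y.+1).

(* <<x, y>, z> ∈ F *)
Definition f_rel2 (F x y z : nat) : formula :=
  FEx F (FEx 0 (FEx 0 (FAnd (f_opair 0 x.+3 y.+3) (f_opair 2 0 z.+3)))).

Lemma f_upairP e u x y : holds e (f_upair u x y) <-> e u = upair (e x) (e y).
Proof. by rewrite -upairP. Qed.

Lemma f_opairP e p x y : holds e (f_opair p x y) <-> e p = opair (e x) (e y).
Proof.
rewrite /f_opair; split.
  move=> [u [up [v [vp [/f_upairP uE [/f_upairP vE /f_upairP pE]]]]]].
  by move: uE vE pE => /= -> -> ->.
move=> pE; exists (upair (e x) (e x)); split.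
  by rewrite pE; apply/elem_upair; left.
exists (upair (e x) (e y)); split; first by rewrite /= pE; apply/elem_upair; right.
by split; [apply/f_upairP|split; apply/f_upairP].
Qed.

Lemma f_relP e F x y : holds e (f_rel F x y) <-> opair (e x) (e y) ∈ e F.
Proof.
rewrite /f_rel; split=> [[p [pF /f_opairP]]|h].
  by rewrite /= => <-.
by exists (opair (e x) (e y)); split => //; apply/f_opairP.
Qed.

Lemma f_rel2P e F x y z :
  holds e (f_rel2 F x y z) <-> opair (opair (e x) (e y)) (e z) ∈ e F.
Proof.
rewrite /f_rel2; split=> [[p [pF [u [up [q [qu [/f_opairP + /f_opairP]]]]]]]|h].
  by rewrite /= => -> <-.
exists (opair (opair (e x) (e y)) (e z)); split => //.
exists (upair (opair (e x) (e y)) (opair (e x) (e y))).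
split; first by apply/elem_upair; left.
exists (opair (e x) (e y)); split; first by apply/elem_upair; left.
by split; apply/f_opairP.
Qed.

(* F is (the graph of) a function from A to B *)
Definition is_fun (A B F : V) : Prop :=
  (forall a, a ∈ A -> exists b, b ∈ B /\ opair a b ∈ F) /\
  (forall p, p ∈ F -> exists a, a ∈ A /\ exists b, b ∈ B /\
     (p = opair a b /\ forall b', b' ∈ B -> opair a b' ∈ F -> b' = b)).

Definition f_is_fun : formula :=
  FAnd (FAll 0 (FEx 2 (f_rel 4 1 0)))
       (FAll 2 (FEx 1 (FEx 3 (FAnd (f_opair 2 1 0)
          (FAll 4 (FImp (f_rel 6 2 0) (FEq 0 1))))))).

Definition env3 (a b c : V) := scons a (scons b (fun=> c)).

Lemma f_is_funP A B F : holds (env3 A B F) f_is_fun <-> is_fun A B F.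
Proof.
rewrite /f_is_fun; split=> -[h1 h2]; split.
- by move=> a /h1[b [bB /f_relP]]; exists b.
- move=> p /h2[a [aA [b [bB [/f_opairP pE h]]]]].
  exists a; split => //; exists b; split => //; split => // b' bB' abF.
  by apply: (h b') => //; apply/f_relP.
- by move=> a /h1[b [bB abF]]; exists b; split => //; apply/f_relP.
- move=> p /h2[a [aA [b [bB [pE h]]]]].
  exists a; split => //; exists b; split => //; split; first exact/f_opairP.
  by move=> b' bB' /f_relP; exact: h.
Qed.

Lemma is_fun_app A B F a b : is_fun A B F -> opair a b ∈ F ->
  b ∈ B /\ app F a = b.
Proof.
move=> [_ h2] abF.
have [a1 [_ [b1 [b1B [/opair_inj[ea eb] u]]]]] := h2 _ abF; subst a1 b1.
split => //; rewrite /app; case: xgetP => [c _ /= acF|/(_ b) //].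
have [a1 [_ [b1 [cB [/opair_inj[ea eb] _]]]]] := h2 _ acF; subst a1 b1.
exact: u.
Qed.

Lemma is_fun_appP A B F a : is_fun A B F -> a ∈ A ->
  app F a ∈ B /\ opair a (app F a) ∈ F.
Proof.
move=> AB aA; have [b [_ abF]] := AB.1 _ aA.
by have [bB ->] := is_fun_app AB abF.
Qed.

(* With the graphs of -, |.| and < as arguments: |a - b| < eps. *)
Definition dist_lt (Rs Sub Abs Lt eps a b : V) : Prop :=
  exists d, d ∈ Rs /\ exists m, m ∈ Rs /\
   (opair (opair a b) d ∈ Sub /\ (opair d m ∈ Abs /\ opair m eps ∈ Lt)).

Definition f_dist_lt (Rs Sub Abs Lt eps a b : nat) : formula :=
  FEx Rs (FEx Rs.+1 (FAnd (f_rel2 Sub.+2 a.+2 b.+2 1)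
    (FAnd (f_rel Abs.+2 1 0) (f_rel Lt.+2 0 eps.+2)))).

Lemma f_dist_ltP e (Rs Sub Abs Lt eps a b : nat) :
  holds e (f_dist_lt Rs Sub Abs Lt eps a b) <->
  dist_lt (e Rs) (e Sub) (e Abs) (e Lt) (e eps) (e a) (e b).
Proof.
split=> [[d [dR [m [mR [/f_rel2P h1 [/f_relP h2 /f_relP h3]]]]]]|].
  by exists d; split => //; exists m.
move=> [d [dR [m [mR [h1 [h2 h3]]]]]].
exists d; split => //; exists m; split => //.
by split; [apply/f_rel2P|split; apply/f_relP].
Qed.

End formulas.

(** * Nonstandard models *)

Definition individuals (S : Type) (V : superstructure S) : V :=
  collect (range (@indiv S V)).

(* The individuals of the nonstandard superstructure form the set *S, and
   [emb] is the inclusion of S in *S. *)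
Record nonstandard_model (S : Type) := NonstandardModel {
  std : superstructure S;
  star_sort : Type;
  nst : superstructure star_sort;
  star : std -> nst;
  emb : S -> star_sort;
  emb_inj : injective emb;
  extension : forall s, star (indiv s) = indiv (emb s);
  star_individuals : star (individuals std) = individuals nst;
  transfer : forall (f : formula) (e : nat -> std),
    holds e f <-> holds (star \o e) f
}.
Arguments star {S n} _.

Definition internal (S : Type) (M : nonstandard_model S) (a : nst M) : Prop :=
  exists A : std M, a ∈ star A.

(* κ-saturation, with κ the cardinality of the type K *)
Definition saturated (S : Type) (M : nonstandard_model S) (K : Type) : Prop :=
  forall F : set (nst M),
    (forall A, F A -> internal A /\ is_set A) ->
    F #<= [set: K] ->
    (forall G, G `<=` F -> finite_set G -> exists x, forall A, G A -> x ∈ A) ->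
    exists x, forall A, F A -> x ∈ A.

Section model_theory.
Context {S : Type} {M : nonstandard_model S}.
Implicit Types (a b A B F : std M).

Lemma star_elem a A : a ∈ A <-> star a ∈ star A.
Proof. exact: (transfer (FElem 0 1) (scons a (fun=> A))). Qed.

Lemma star_subset A B : (forall x, x ∈ A -> x ∈ B) ->
  forall x, x ∈ star A -> x ∈ star B.
Proof.
move=> AB.
by have /= := (transfer (FAll 0 (FElem 0 2)) (scons A (fun=> B))).1 AB.
Qed.

Lemma star_opair a b : star (opair a b) = opair (star a) (star b).
Proof.
have /transfer/f_opairP : holds (env3 a b (opair a b)) (f_opair 2 0 1).
  exact/f_opairP.
by [].
Qed.

Lemma star_is_fun A B F : is_fun A B F -> is_fun (star A) (star B) (star F).
Proof.
move=> /f_is_funP/transfer h; apply/f_is_funP.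
by congr (holds _ _) : h; apply/funext => -[|[|[]]].
Qed.

End model_theory.

(** * The spaces associated with X *)

(* A set S of individuals containing X and R (which need not be disjoint) *)
Record ground (X R : Type) := Ground {
  ground_sort :> Type;
  inX : X -> ground_sort;
  inR : R -> ground_sort;
  inX_inj : injective inX;
  inR_inj : injective inR
}.

Section real_line.
Context {X : Type} {R : realType} {S : ground X R}.
Variable M : nonstandard_model S.

Definition real (r : R) : std M := indiv (inR S r).
Definition point_of (x : X) : std M := indiv (inX S x).

Definition set_entity (G : set X) : std M := collect (point_of @` G).
Definition real_set : std M := collect (range real).
Definition real_square : std M :=
  collect [set p | exists r s, p = opair (real r) (real s)].

Definition graph (f : X -> R) : std M :=
  collect [set p | exists x, p = opair (point_of x) (real (f x))].
Definition sub_graph : std M :=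
  collect [set p | exists r s, p = opair (opair (real r) (real s)) (real (r - s))].
Definition norm_graph : std M :=
  collect [set p | exists r, p = opair (real r) (real `|r|)].
Definition lt_graph : std M :=
  collect [set p | exists r s, r < s /\ p = opair (real r) (real s)].

(* *-, *|.| and *< on *R *)
Definition hsub (xi eta : nst M) : nst M := app (star sub_graph) (opair xi eta).
Definition hnorm (xi : nst M) : nst M := app (star norm_graph) xi.
Definition hlt (xi eta : nst M) : Prop := opair xi eta ∈ star lt_graph.

Definition hfinite (xi : nst M) : Prop :=
  exists n : nat, hlt (hnorm xi) (star (real n%:R)).
Definition hnear (xi eta : nst M) : Prop :=
  forall n : nat, hlt (hnorm (hsub xi eta)) (star (real n.+1%:R^-1)).

Lemma level_real r : level (@indiv S (std M)) elem 0 (real r).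
Proof. by exists (inR S r). Qed.

Lemma level_point x : level (@indiv S (std M)) elem 0 (point_of x).
Proof. by exists (inX S x). Qed.

Lemma real_inj : injective real.
Proof. by move=> r s h; apply: (@inR_inj _ _ S); exact: indiv_inj h. Qed.

Lemma point_inj : injective point_of.
Proof. by move=> r s h; apply: (@inX_inj _ _ S); exact: indiv_inj h. Qed.

Lemma set_entityP G y : y ∈ set_entity G <-> exists2 x, G x & point_of x = y.
Proof.
apply: (collectP (k := 0)) => z [x _ <-]; exact: level_point.
Qed.

Lemma elem_set_entity G x : point_of x ∈ set_entity G <-> G x.
Proof.
by rewrite set_entityP; split=> [[y Gy /point_inj <-]|Gx] //; exists x.
Qed.

Lemma real_setP y : y ∈ real_set <-> exists r, y = real r.
Proof.
rewrite (collectP (k := 0)); last by move=> z [r _ <-]; exact: level_real.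
by split=> [[r _ <-]|[r ->]]; exists r.
Qed.

Lemma elem_real r : real r ∈ real_set.
Proof. by apply/real_setP; exists r. Qed.

Lemma real_squareP p : p ∈ real_square <-> exists r s, p = opair (real r) (real s).
Proof.
apply: (collectP (k := 2)) => z [r [s ->]].
by apply: opair_level; exact: level_real.
Qed.

Lemma graphP f p : p ∈ graph f <-> exists x, p = opair (point_of x) (real (f x)).
Proof.
apply: (collectP (k := 2)) => z [x ->].
by apply: opair_level; [exact: level_point|exact: level_real].
Qed.

Lemma sub_graphP p : p ∈ sub_graph <->
  exists r s, p = opair (opair (real r) (real s)) (real (r - s)).
Proof.
apply: (collectP (k := 4)) => z [r [s ->]].
apply: opair_level; first by apply: opair_level; exact: level_real.
by apply: (@level_le _ _ 0) (level_real _).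
Qed.

Lemma norm_graphP p : p ∈ norm_graph <->
  exists r, p = opair (real r) (real `|r|).
Proof.
apply: (collectP (k := 2)) => z [r ->].
by apply: opair_level; exact: level_real.
Qed.

Lemma lt_graphP p : p ∈ lt_graph <->
  exists r s, r < s /\ p = opair (real r) (real s).
Proof.
apply: (collectP (k := 2)) => z [r [s [_ ->]]].
by apply: opair_level; exact: level_real.
Qed.

Lemma graph_fun f : is_fun (set_entity setT) real_set (graph f).
Proof.
split=> [_ /set_entityP[x _ <-]|_ /graphP[x ->]].
  by exists (real (f x)); split; [exact: elem_real|apply/graphP; exists x].
exists (point_of x); split; first exact/elem_set_entity.
exists (real (f x)); split; first exact: elem_real.
by split => // b _ /graphP[y /opair_inj[/point_inj -> ->]].
Qed.

Lemma sub_graph_fun : is_fun real_square real_set sub_graph.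
Proof.
split=> [_ /real_squareP[r [s ->]]|_ /sub_graphP[r [s ->]]].
  exists (real (r - s)); split; first exact: elem_real.
  by apply/sub_graphP; exists r, s.
exists (opair (real r) (real s)); split; first by apply/real_squareP; exists r, s.
exists (real (r - s)); split; first exact: elem_real.
split => // b _ /sub_graphP[r' [s' /opair_inj[]]].
by move=> /opair_inj[/real_inj -> /real_inj ->].
Qed.

Lemma norm_graph_fun : is_fun real_set real_set norm_graph.
Proof.
split=> [_ /real_setP[r ->]|_ /norm_graphP[r ->]].
  by exists (real `|r|); split; [exact: elem_real|apply/norm_graphP; exists r].
exists (real r); split; first exact: elem_real.
exists (real `|r|); split; first exact: elem_real.
by split => // b _ /norm_graphP[s /opair_inj[/real_inj -> ->]].
Qed.

Lemma star_real_square xi eta : xi ∈ star real_set -> eta ∈ star real_set ->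
  opair xi eta ∈ star real_square.
Proof.
pose f := FAll 0 (FAll 1 (f_rel 3 1 0)).
have /transfer h : holds (env3 real_set real_square real_square) f.
  move=> _ /real_setP[r ->] _ /real_setP[s ->]; apply/f_relP.
  by apply/real_squareP; exists r, s.
by move=> hx he; have /f_relP := h _ hx _ he.
Qed.

Let std_dist := dist_lt real_set sub_graph norm_graph lt_graph.
Let nst_dist := dist_lt (star real_set) (star sub_graph) (star norm_graph)
  (star lt_graph).

Let std_distP r s t : std_dist (real t) (real r) (real s) <-> `|r - s| < t.
Proof.
split=> [[_ [/real_setP[d ->] [_ [/real_setP[m ->]]]]]|rst].
  move=> [/sub_graphP[r' [s' /opair_inj[/opair_inj[]]]]].
  move=> /real_inj <- /real_inj <- /real_inj ->.
  move=> [/norm_graphP[d' /opair_inj[/real_inj <- /real_inj ->]]].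
  by move=> /lt_graphP[m' [t' [+ /opair_inj[/real_inj -> /real_inj ->]]]].
exists (real (r - s)); split; first exact: elem_real.
exists (real `|r - s|); split; first exact: elem_real.
split; first by apply/sub_graphP; exists r, s.
split; first by apply/norm_graphP; exists (r - s).
by apply/lt_graphP; exists `|r - s|, t.
Qed.

Let nst_distP xi eta t : xi ∈ star real_set -> eta ∈ star real_set ->
  nst_dist t xi eta <-> hlt (hnorm (hsub xi eta)) t.
Proof.
move=> hx he; have subF := star_is_fun sub_graph_fun.
have normF := star_is_fun norm_graph_fun.
split=> [[d [_ [m [_ [hd [hm ht]]]]]]|ht].
  have [_ dE] := is_fun_app subF hd; have [_ mE] := is_fun_app normF hm.
  by rewrite /hlt /hnorm /hsub dE mE.
have [dR dE] := is_fun_appP subF (star_real_square hx he).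
have [mR mE] := is_fun_appP normF dR.
by exists (hsub xi eta); split => //; exists (hnorm (hsub xi eta)).
Qed.

Let env (e d : std M) := scons real_set (scons sub_graph (scons norm_graph
  (scons lt_graph (scons e (fun=> d))))).

Lemma hnear_refl xi : xi ∈ star real_set -> hnear xi xi.
Proof.
move=> hx n; apply/nst_distP => //.
pose e : std M := real n.+1%:R^-1.
have /transfer h : holds (env e e) (FAll 0 (f_dist_lt 1 2 3 4 5 0 0)).
  move=> _ /real_setP[r ->]; apply/f_dist_ltP/std_distP.
  by rewrite subrr normr0 invr_gt0 ltr0n.
by have /f_dist_ltP := h _ hx.
Qed.

Lemma hnear_sym xi eta : xi ∈ star real_set -> eta ∈ star real_set ->
  hnear xi eta -> hnear eta xi.
Proof.
move=> hx he near n; apply/nst_distP => //.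
pose e : std M := real n.+1%:R^-1.
have /transfer h : holds (env e e) (FAll 0 (FAll 1 (FImp
    (f_dist_lt 2 3 4 5 6 1 0) (f_dist_lt 2 3 4 5 6 0 1)))).
  move=> _ /real_setP[r ->] _ /real_setP[s ->] /f_dist_ltP/std_distP rs.
  by apply/f_dist_ltP/std_distP; rewrite distrC.
have hxe : holds (scons eta (scons xi (star \o env e e))) (f_dist_lt 2 3 4 5 6 1 0).
  by apply/f_dist_ltP/nst_distP => //; exact: near.
by have /f_dist_ltP := h _ hx _ he hxe.
Qed.

Lemma hnear_trans xi eta zeta : xi ∈ star real_set -> eta ∈ star real_set ->
  zeta ∈ star real_set -> hnear xi eta -> hnear eta zeta -> hnear xi zeta.
Proof.
move=> hx he hz xe ez n; apply/nst_distP => //.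
pose e : std M := real n.+1%:R^-1; pose d : std M := real (n.*2.+1).+1%:R^-1.
have /transfer h : holds (env e d) (FAll 0 (FAll 1 (FAll 2 (FImp
    (f_dist_lt 3 4 5 6 8 2 1) (FImp (f_dist_lt 3 4 5 6 8 1 0)
    (f_dist_lt 3 4 5 6 7 2 0)))))).
  move=> _ /real_setP[r ->] _ /real_setP[s ->] _ /real_setP[t ->].
  move=> /f_dist_ltP/std_distP rs /f_dist_ltP/std_distP st.
  apply/f_dist_ltP/std_distP.
  rewrite (le_lt_trans (ler_distD s _ _))// (lt_le_trans (ltrD rs st))//.
  by rewrite -doubleS -mul2n natrM invfM mulrC -splitr.
pose e' := scons zeta (scons eta (scons xi (star \o env e d))).
have hxe : holds e' (f_dist_lt 3 4 5 6 8 2 1).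
  by apply/f_dist_ltP; apply/(nst_distP (star d) hx he); exact: (xe n.*2.+1).
have hez : holds e' (f_dist_lt 3 4 5 6 8 1 0).
  by apply/f_dist_ltP; apply/(nst_distP (star d) he hz); exact: (ez n.*2.+1).
by have /f_dist_ltP := h _ hx _ he _ hz hxe hez.
Qed.

End real_line.

Section spaces.
Context {X : topologicalType} {R : realType} {S : ground X R}.
Variable M : nonstandard_model S.

Definition starX : Type := [set a : nst M | a ∈ star (set_entity M [set: X])].

HB.instance Definition _ := Choice.copy starX
  (set_type [set a : nst M | a ∈ star (set_entity M [set: X])]).

Definition ent (a : starX) : nst M := set_val a.

(* *G, as a subset of *X *)
Definition star_open (G : set X) : set starX :=
  [set a | ent a ∈ star (set_entity M G)].

Lemma ent_starX (a : starX) : ent a ∈ star (set_entity M [set: X]).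
Proof. exact: set_mem (svalP a). Qed.

Lemma star_open_cover : \bigcup_(G in @open X) star_open G = setT.
Proof.
apply/seteqP; split => // a _; exists setT; first exact: openT.
exact: ent_starX.
Qed.

Lemma star_open_join (G H : set X) (a : starX) : open G -> open H ->
  star_open G a -> star_open H a ->
  exists L, [/\ open L, star_open L a & star_open L `<=` star_open G `&` star_open H].
Proof.
move=> oG oH Ga Ha; exists (G `&` H); split; first exact: openI.
  pose f := FAll 0 (FImp (FElem 0 2) (FElem 0 3)).
  have /transfer h : holds (env3 (set_entity M G) (set_entity M H)
      (set_entity M (G `&` H))) f.
    by move=> _ /set_entityP[x Gx <-] /elem_set_entity Hx; apply/elem_set_entity.
  exact: h.
by move=> b Lb; split; apply: star_subset Lb => _ /set_entityP[x [? ?] <-];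
  apply/elem_set_entity.
Qed.

(* The standard topology sT, with base {*G : G open} *)
HB.instance Definition _ := isBaseTopological.Build starX
  star_open_cover star_open_join.

Definition star_fun (f : X -> R) (a : starX) : nst M := app (star (graph M f)) (ent a).

Lemma star_fun_real f a : star_fun f a ∈ star (real_set M).
Proof. exact: (is_fun_appP (star_is_fun (graph_fun M f)) (ent_starX a)).1. Qed.

(* The inclusion of X in *X: by extension, *x = x. *)
Definition inclX (x : X) : starX :=
  exist _ (star (point_of M x))
    (mem_set ((star_elem _ _).1 ((elem_set_entity M setT x).2 I))).

Lemma star_fun_incl f x : star_fun f (inclX x) = star (real M (f x)).
Proof.
apply: (is_fun_app (star_is_fun (graph_fun M f)) _).2.
by rewrite -star_opair -star_elem; apply/graphP; exists x.
Qed.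

Definition Cb : set (X -> R) := [set f | continuous f /\ bounded_fun f].

Variable Phi : set (X -> R).

(* As a type, Xtilde carries the subspace topology. *)
Definition Xtilde : set starX := [set a | forall f, Phi f -> hfinite (star_fun f a)].

Definition sim (a b : Xtilde) : Prop :=
  forall f, Phi f -> hnear (star_fun f (val a)) (star_fun f (val b)).

Definition simb (a b : Xtilde) : bool := `[< sim a b >].

Lemma sim_equiv : equiv_class_of simb.
Proof.
split=> [a|a b|b a c].
- by apply/asboolP => f _; apply: hnear_refl; exact: star_fun_real.
- by apply/asboolP/asboolP => h f /h; apply: hnear_sym; exact: star_fun_real.
- by move=> /asboolP ab /asboolP bc; apply/asboolP => f Pf;
    apply: hnear_trans (ab f Pf) (bc f Pf); exact: star_fun_real.
Qed.

Canonical sim_equiv_rel := EquivRelPack sim_equiv.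

Definition Xhat : Type := quotient_topology {eq_quot sim_equiv_rel}.
HB.instance Definition _ :=
  Topological.copy Xhat (quotient_topology {eq_quot sim_equiv_rel}).

Definition q (a : Xtilde) : Xhat := (\pi_{eq_quot sim_equiv_rel} a).

Lemma inclX_Xtilde x : Xtilde (inclX x).
Proof.
move=> f _; rewrite star_fun_incl; exists (Num.truncn `|f x|).+1.
rewrite /hnorm (is_fun_app (b := star (real M `|f x|))
  (star_is_fun (norm_graph_fun M)) _).2; last first.
  by rewrite -star_opair -star_elem; apply/norm_graphP; exists (f x).
rewrite /hlt -star_opair -star_elem; apply/lt_graphP.
by exists `|f x|, (Num.truncn `|f x|).+1%:R; split => //; exact: truncnS_gt.
Qed.

(* X as a subset of Xtilde *)
Definition X_in_Xtilde (x : X) : Xtilde := exist _ (inclX x) (mem_set (inclX_Xtilde x)).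

End spaces.

Arguments Cb : clear implicits.
Arguments Xtilde {X R S} M Phi _.
Arguments Xhat {X R S} M Phi.
Arguments q {X R S} M Phi a.
Arguments X_in_Xtilde {X R S} M Phi x.

(* Main.v *)
(** Bounds on members of [Phi] transfer to *X, which gives (i).  For (ii), *X is
compact: if [F] is a filter on *X, the internal sets *(X \ G), with G open and
*(X \ G) in [F], have the finite intersection property and are no more numerous
than the open sets, so saturation yields a point in all of them; as the *G form
a base, this is a cluster point of [F].  The space [Xhat] is then a continuous
image of *X = [Xtilde], and [X] maps continuously into *X. *)
Require Import Defs.
From HB Require Import structures.
From mathcomp Require Import all_boot all_order all_algebra finmap.
From mathcomp Require Import all_classical all_reals all_analysis.
Import Order.TTheory GRing.Theory Num.Theory.
Import numFieldNormedType.Exports.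

Set Implicit Arguments.
Unset Strict Implicit.
Unset Printing Implicit Defensive.

Local Open Scope classical_set_scope.
Local Open Scope ring_scope.
Local Open Scope card_scope.
Local Open Scope quotient_scope.

#[local] Arguments star_open {X R S} M G _.

Section standard_topology.
Context {X : topologicalType} {R : realType} {S : ground X R}.
Variable M : nonstandard_model S.

(** Two bounded sentences are transferred: [G] and its complement are disjoint, and together they
    cover [X]. *)
Lemma star_openC (G : set X) : star_open M (~` G) = ~` star_open M G.
Proof.
pose e := env3 (set_entity M setT) (set_entity M G) (set_entity M (~` G)).
have /transfer h1 : holds e (FAll 1 (FImp (FElem 0 3) (FNot (FElem 0 2)))).
  by move=> _ _ /set_entityP[x nGx <-] /elem_set_entity.
have /transfer h2 : holds e (FAll 0 (FImp (FNot (FElem 0 2)) (FElem 0 3))).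
  move=> _ /set_entityP[x _ <-] nGx; apply/elem_set_entity => Gx; apply: nGx.
  exact/elem_set_entity.
apply/seteqP; split => a; first by move=> nGa Ga; exact: (h1 _ Ga nGa Ga).
by move=> nGa; exact: (h2 _ (ent_starX a) nGa).
Qed.

Lemma ent_surj (y : nst M) : y ∈ star (set_entity M setT) ->
  exists a : starX M, ent a = y.
Proof.
move=> yX.
by exists (SigSub (mem_set (yX : [set a | a ∈ star (set_entity M setT)] y))).
Qed.

(** An individual [*G] would belong to [*S], the set of all individuals; transfer back would put [G]
    in [S], although [G] is a set. This also covers empty [G]. *)
Lemma is_set_star_set_entity (G : set X) : is_set (star (set_entity M G)).
Proof.
move=> [s _ sG].
have : star (set_entity M G) ∈ individuals (nst M).
  by apply/(collectP (k := 0)) => //; exists s.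
rewrite -star_individuals -star_elem (collectP (k := 0)) // => -[t _ tG].
have P0 : point_of M @` G `<=` level (@indiv S (std M)) elem 0.
  by move=> z [x _ <-]; exact: level_point.
by apply: (collect_spec P0).1; exists t.
Qed.

Lemma openE_starX (U : set (starX M)) : open U <->
  forall a, U a -> exists G, [/\ open G, star_open M G a & star_open M G `<=` U].
Proof.
split=> [[D Dopen <-] a [G DG Ga]|h].
  by exists G; split => [|//|b Gb]; [exact: Dopen|exists G].
exists [set G | open G /\ star_open M G `<=` U]; first by move=> G [].
by apply/seteqP; split => [a [G [_ GU] /GU]|a /h[G [? ? ?]]] //; exists G.
Qed.

Lemma compact_starX (K : Type) : saturated M K ->
  [set G : set X | open G] #<= [set: K] -> compact [set: starX M].
Proof.
move=> satM TK F PF _.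
pose E : set (set X) := [set G | open G /\ F (star_open M (~` G))].
have [y yE] : exists y, forall A, [set star (set_entity M (~` G)) | G in E] A ->
    y ∈ A.
  apply: satM => [_ [G _ <-]||D DE /finite_fsetP[D' DD']].
  - split; last exact: is_set_star_set_entity.
    (* Subsets of [X] are elements of [V_1(S)], so their stars are elements of [*V_1(S)], hence
       internal. *)
    exists (collect (level (@indiv S (std M)) elem 1)); apply/star_elem.
    apply/(collectP (k := 1)) => //; apply: (collect_level (k := 0)).
    by move=> z [x _ <-]; exact: level_point.
  - apply: card_le_trans TK; apply: card_le_trans (card_image_le _ _) _.
    by apply: subset_card_le => G [].
  (* A finite intersection of members of the proper filter [F] lies in [F], so it has a point. *)
  - have : F (\bigcap_(A in [set` D']) [set a : starX M | ent a ∈ A]).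
      apply: filter_bigI => A AD.
      have /DE[G [_ FG] <-] : D A by rewrite DD'.
      exact: FG.
    move=> /filter_ex[a aD]; exists (ent a) => A; rewrite DD' => /aD; exact.
have [a ay] : exists a : starX M, ent a = y.
  (* G = set0 belongs to E, which puts y in *X. *)
  apply: ent_surj; rewrite -setC0; apply: yE; exists set0 => //.
  split; first exact: open0.
  rewrite setC0 (_ : star_open M setT = setT); first exact: filterT.
  by apply/seteqP; split => // b _; exact: ent_starX.
exists a; split => // B N FB; rewrite nbhsE => -[U [/openE_starX oU Ua] UN].
have [G [oG Ga GU]] := oU a Ua.
(* If [B] missed [N], it would lie in [*(X \ G)], so [G] would be in [E] and [a] in [*(X \ G)],
   against [a] in [*G]. *)
apply: contrapT => BN; have : star_open M (~` G) a.
  rewrite /star_open /= ay; apply: yE; exists G => //; split => //.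
  rewrite star_openC; apply: filterS FB => b Bb Gb; apply: BN.
  by exists b; split => //; exact/UN/GU.
by rewrite star_openC.
Qed.

Lemma continuous_inclX : continuous (inclX M : X -> starX M).
Proof.
move=> x N; rewrite nbhsE => -[U [/openE_starX oU Ux] UN].
have [G [oG Gx GU]] := oU _ Ux.
(* By transfer, [*G] meets [X] exactly in [G]. *)
have inG z : star_open M G (inclX M z) <-> G z.
  by rewrite -(elem_set_entity M G z) star_elem.
apply: filterS (open_nbhs_nbhs (conj oG ((inG x).1 Gx))) => z /inG Gz.
exact/UN/GU.
Qed.

End standard_topology.

Section completion.
Context {X : topologicalType} {R : realType} {S : ground X R}.
Variable M : nonstandard_model S.

(** Formulas have no function application, so the transferred sentence names [f x] and its absolute
    value as witnesses [r] and [m] related through the graphs. *)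
Lemma star_fun_bounded (f : X -> R) (n : nat) (a : starX M) :
  (forall x, `|f x| < n%:R) -> hlt (hnorm (star_fun f a)) (star (real M n%:R)).
Proof.
move=> fn.
pose e : nat -> std M := scons (set_entity M setT) (scons (graph M f)
  (scons (real_set M) (scons (norm_graph M) (scons (lt_graph M)
  (fun=> real M n%:R))))).
have /transfer h : holds e (FAll 0 (FEx 3 (FEx 4 (FAnd (f_rel 4 2 1)
    (FAnd (f_rel 6 1 0) (f_rel 7 0 8)))))).
  move=> _ /set_entityP[x _ <-].
  exists (real M (f x)); split; first exact: elem_real.
  exists (real M `|f x|); split; first exact: elem_real.
  split; first by apply/f_relP/graphP; exists x.
  split; first by apply/f_relP/norm_graphP; exists (f x).
  by apply/f_relP/lt_graphP; exists `|f x|, n%:R.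
have [r [_ [m [_ [/f_relP fr [/f_relP rm /f_relP mn]]]]]] := h _ (ent_starX a).
have [_ fE] := is_fun_app (star_is_fun (graph_fun M f)) fr.
have [_ mE] := is_fun_app (star_is_fun (norm_graph_fun M)) rm.
by rewrite /hlt /hnorm /star_fun fE mE.
Qed.

Lemma Xtilde_Cb (Phi : set (X -> R)) : Phi `<=` Cb X R -> Xtilde M Phi = setT.
Proof.
move=> PhiC; apply/seteqP; split => // a _ f /PhiC[_ [b [_ fb]]].
(* [fb] bounds [|f x|] weakly by every real above [b], such as [b + 1]; the successor of its
   truncation makes the bound a natural number and strict. *)
exists (Num.truncn (b + 1)).+1; apply: star_fun_bounded => x.
apply: le_lt_trans (truncnS_gt _).
by apply: (fb (b + 1)) => //; rewrite ltrDl.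
Qed.

(** The identity of [*X], needed as a map because [Xtilde] is a distinct type even when it is all of
    [*X]. *)
Definition to_Xtilde (Phi : set (X -> R)) (XT : forall a, Xtilde M Phi a)
  (a : starX M) : Xtilde M Phi := SigSub (mem_set (XT a)).

(** The subspace topology is initial for the inclusion into [*X], and composing with that inclusion
    gives the identity. *)
Lemma continuous_to_Xtilde Phi (XT : forall a, Xtilde M Phi a) :
  continuous (to_Xtilde XT).
Proof.
by apply: continuous_comp_initial => x; exact: cvg_id.
Qed.

Lemma continuous_q (Phi : set (X -> R)) : continuous (q M Phi).
Proof. exact: pi_continuous. Qed.

Lemma q_surj (Phi : set (X -> R)) (z : Xhat M Phi) : exists a, q M Phi a = z.
Proof. by exists (repr (z : {eq_quot (sim_equiv_rel M Phi)})); exact: reprK. Qed.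

End completion.

Theorem mainTheorem4 (X : topologicalType) (R : realType) (S : ground X R)
    (M : nonstandard_model S) (K : Type)
    (K_infinite : infinite_set [set: K])
    (T_lt_K : ([set G : set X | open G] #<= [set: K]) /\
              ~ ([set: K] #<= [set G : set X | open G]))
    (M_saturated : saturated M K)
    (Phi : set (X -> R)) (Phi_Cb : Phi `<=` Cb X R) :
  Xtilde M Phi = [set: starX M] /\
  (compact [set: Xhat M Phi] /\
   continuous (fun x : X => q M Phi (X_in_Xtilde M Phi x))).
Proof.
have XtT := Xtilde_Cb M Phi_Cb; split => //.
have XT a : Xtilde M Phi a by rewrite XtT.
have qc : continuous (q M Phi \o to_Xtilde XT).
  move=> a; apply: continuous_comp; first exact: continuous_to_Xtilde.
  exact: continuous_q.
split.
  have -> : [set: Xhat M Phi] = (q M Phi \o to_Xtilde XT) @` setT.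
    apply/seteqP; split => // z _; have [a <-] := q_surj z.
    by exists (val a) => //=; congr (q M Phi _); exact: val_inj.
  apply: continuous_compact; last exact: compact_starX M_saturated T_lt_K.1.
  exact: continuous_subspaceT.
(* The map on [X] factors through [*X], where continuity is already known. *)
have -> : (fun x => q M Phi (X_in_Xtilde M Phi x)) =
    (q M Phi \o to_Xtilde XT) \o inclX M.
  by apply/funext => x /=; congr (q M Phi _); exact: val_inj.
move=> x; apply: continuous_comp; [exact: continuous_inclX|exact: qc].
Qed.
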